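(* For every integer $n\geq 2$, the extraspecial $2$-group $Q_2D_4^{(n-1)} := Q_2\circ D_4\circ\cdots\circ D_4$ (with $n-1$ copies of $D_4$) is strongly real but not totally orthogonal.
   Context: $D_4=\langle a,b : a^4=b^2=1, bab^{-1}=a^{-1}\rangle$ is the dihedral group of order $8$ and $Q_2=\langle c,d : c^4=1, d^2=c^2, dcd^{-1}=c^{-1}\rangle$ is the quaternion group of order $8$. Central product: for groups $G_1,G_2$ and an isomorphism $\theta:Z(G_1)\to Z(G_2)$, $G_1\circ G_2$ is the quotient of $G_1\times G_2$ by $N=\{(x,y)\in Z(G_1)\times Z(G_2) : \theta(x)y=1\}$. Here all centers have order $2$, so $\theta$ is the unique isomorphism; iterated central products are formed successively. An element of a group is strongly real if it is a product of two elements each equal to its own inverse (i.e. elements $y$ with $y^2=1$, the identity allowed). A group is strongly real if all its elements are. A group is real if every element is conjugate to its inverse. A finite real group is totally orthogonal if it admits no symplectic representation, i.e. if all its (irreducible) complex representations are realizable over $\mathbb{R}$. *)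

(* Defs.v *)
From HB Require Import structures.
From mathcomp Require Import all_boot all_order all_algebra.
From mathcomp Require Import all_fingroup all_solvable all_character.
From mathcomp Require Import reals.
From mathcomp.real_closed Require Import complex.

Set Implicit Arguments.
Unset Strict Implicit.
Unset Printing Implicit Defensive.

Import GroupScope.

(* Q_2 o D_4 o ... o D_4 with k copies of D_4, associated to the left.  The
   quaternion group Q_2 and the dihedral group D_4, both of order 8, are 'Q_8
   and 'D_8; Grp_quaternion and Grp_2dihedral give their presentations.
   [xcprod H K] is the central product only when 'Z(H) and 'Z(K) are
   isomorphic: [Q2D4P] shows that this is always the case here, and
   [card_center_Q2D4] that the centers have order 2, so that there is only
   one way to identify them. *)
Fixpoint Q2D4 (k : nat) : finGroupType :=
  if k is k'.+1 then xcprod [set: Q2D4 k']%G 'D_8%G else ('Q_8)%type.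

Lemma card_center_D8 : #|'Z('D_8)| = 2.
Proof.
have esD8 : extraspecial 'D_8.
  by apply: isog_extraspecial isog_2X1p2 _; exact: pX1p2_extraspecial.
by apply: card_center_extraspecial esD8; rewrite /pgroup (@card_2dihedral 3).
Qed.

Lemma card_center_Q2D4 k : #|'Z([set: Q2D4 k])| = 2.
Proof.
elim: k => [|k IHk] /=.
  have pQ : 2.-group 'Q_8 by rewrite /pgroup (@card_quaternion 3).
  exact: card_center_extraspecial pQ Q8_extraspecial.
have [|gz isoZ] := @xcprodP _ _ [set: Q2D4 k]%G 'D_8%G.
  by rewrite isog_cyclic_card ?prime_cyclic ?IHk ?card_center_D8.
by rewrite -(cpairg1_center isoZ) card_injm ?injm_cpairg1 ?center_sub.
Qed.

Lemma Q2D4P k : xcprod_spec [set: Q2D4 k]%G 'D_8%G (Q2D4 k.+1).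
Proof.
apply: xcprodP.
by rewrite isog_cyclic_card ?prime_cyclic ?card_center_Q2D4 ?card_center_D8.
Qed.

Section Reality.

Variables (gT : finGroupType) (G : {group gT}).

Definition strongly_real : Prop :=
  forall g, g \in G ->
    exists x y, [/\ x \in G, y \in G, x^-1 = x, y^-1 = y & g = x * y].

Definition real_group : Prop :=
  forall g, g \in G -> exists2 x, x \in G & g ^ x = g^-1.

Definition realizable_over_reals (R : realType) (n : nat)
    (rG : mx_representation R[i] G n) : Prop :=
  exists rG0 : mx_representation R G n,
    mx_rsim rG (map_repr (real_complex R) rG0).

(* Strongly real groups are real, so for them only the second component can
   fail. *)
Definition totally_orthogonal (R : realType) : Prop :=
  real_group /\
  forall (n : nat) (rG : mx_representation R[i] G n),
    mx_irreducible rG -> realizable_over_reals rG.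

End Reality.

(* Main.v *)
(* Write z for the central element of order 2.

   Strong reality.  In Q_2 o D_4 every element u d is a product of two
   involutions: factor u and d so that corresponding factors either are both
   involutions or both square to z.  Every element of D_4 is a product of two
   involutions, so one more central factor D_4 preserves strong reality.

   Failure of total orthogonality.  Let G = Q_2 o D_4 o ... o D_4 with k copies
   of D_4.  In a nonzero real representation with z = -1, the images of Q_2 span
   a copy of the quaternions, so the restriction to Q_2 has dimension at least
   4, and each D_4 doubles this bound: a noncentral involution s of D_4 is
   conjugate to z s, so its two eigenspaces have the same dimension, and both
   are stable under the remaining factors.  The dimension is thus at least
   4 * 2^k.  But there is a complex irreducible representation with z = -1, and
   its degree n satisfies n^2 <= |G| = 8 * 4^k. *)

Require Import Defs.
From HB Require Import structures.
From mathcomp Require Import all_boot all_order all_algebra.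
From mathcomp Require Import all_fingroup all_solvable all_character.
From mathcomp Require Import reals.
From mathcomp.real_closed Require Import complex.
From mathcomp Require Import ring lra zify.

Set Implicit Arguments.
Unset Strict Implicit.
Unset Printing Implicit Defensive.

Import GroupScope.

(** * Squares and factorizations in ['Q_8] and ['D_8] *)

Lemma invg_id_of_sq (gT : finGroupType) (x : gT) : x * x = 1 -> x^-1 = x.
Proof. by move=> x2; apply/eqP; rewrite eq_invg_mul x2. Qed.

Lemma D8_generators :
  exists x y, [/\ [/\ x \in 'D_8, y \in 'D_8 & y \notin <[x]>],
    {in 'D_8 :\: <[x]>, forall t, t * t = 1}, #[x] = 4
    & x * x \in 'Z('D_8) /\ x ^ y = x^-1].
Proof.
have [[x y] genG [_ xy]] := generators_2dihedral (n := 3) isT (isog_refl 'D_8).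
have [/= oG Gx ox /setDP[Gy X'y]] := genG.
have [[_ o2 _] _ _ _ [defZ _ _ _ _]] :=
  dihedral2_structure (n := 3) isT genG (isog_refl 'D_8).
exists x, y; split=> //; last by split; rewrite // defZ; apply: cycle_id.
by move=> t /o2/eqP; rewrite -expg2 eqn_dvd order_dvdn => /andP[/eqP].
Qed.

Lemma Q8_generators :
  exists x y, [/\ [/\ x \in 'Q_8, y \in 'Q_8 & y \notin <[x]>],
    {in 'Q_8 :\: <[x]>, forall t, t * t = x * x}, #[x] = 4
    & x * x \in 'Z('Q_8) /\ x ^ y = x^-1].
Proof.
have [[x y] genG [_ _ xy]] := generators_quaternion (n := 3) isT (isog_refl 'Q_8).
have [/= oG Gx ox /setDP[Gy X'y]] := genG.
have [[_ o4 _] _ [defZ _ uniq2 _ _] _ _] :=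
  quaternion_structure (n := 3) isT genG (isog_refl 'Q_8).
exists x, y; split=> //; last by split; rewrite // defZ; apply: cycle_id.
move=> t X't; have Gt := subsetP (subsetDl _ _) _ X't.
by rewrite -!expg2; apply: uniq2; [exact: groupX | rewrite orderXdiv o4].
Qed.

(** A subgroup [A] containing [x * x] omits at most [x] and [x^-1] from [<[x]>], and both square to
    [x * x]. Below, [A] is the center. *)
Lemma sqr_cycle4 (gT : finGroupType) (x u : gT) (A : {group gT}) :
  #[x] = 4 -> x * x \in A -> u \in <[x]> -> u \notin A -> u * u = x * x.
Proof.
move=> ox Ax Xu; have [i + ->] := cyclePmin Xu; rewrite ox {u Xu} => lti.
case: i lti => [|[|[|[|//]]]] _; rewrite ?group1 ?expg2 ?Ax // => _.
have x4 : x ^+ 4 = 1 by rewrite -ox expg_order.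
by rewrite -expgD (expgD x 4 2) x4 mul1g expg2.
Qed.

Lemma sqr_neq1_order4 (gT : finGroupType) (x : gT) : #[x] = 4 -> x * x != 1.
Proof. by move=> ox; rewrite -expg2 -order_dvdn ox. Qed.

(** Take z = x^2. If [u] lies in [<[x]>], then [u * y^-1] and [y] lie outside it and square to z;
    otherwise [x] and [x^-1 * u] are the factors. *)
Lemma Q8_factor :
  exists z, [/\ z \in 'Z('Q_8), z != 1,
    forall u, u \notin 'Z('Q_8) -> u * u = z
    & forall u : 'Q_8, exists a b, [/\ u = a * b, a * a = z & b * b = z]].
Proof.
have [x [y [[Gx Gy X'y] sqX' ox [Zxx _]]]] := Q8_generators.
have {}sqX' t : t \notin <[x]> -> t * t = x * x.
  by move=> X't; apply: sqX'; rewrite !inE X't.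
exists (x * x); split=> //; first exact: sqr_neq1_order4.
  move=> u Z'u; case: (boolP (u \in <[x]>)) => [Xu | /sqX'//].
  exact: sqr_cycle4 ox Zxx Xu Z'u.
move=> u; case: (boolP (u \in <[x]>)) => Xu.
  exists (u * y^-1), y; rewrite mulgKV (sqX' y) // (sqX' (_ * _)) //.
  by rewrite groupMl // groupV.
exists x, (x^-1 * u); rewrite mulKVg (sqX' (_ * _)) //.
by rewrite groupMl // groupV cycle_id.
Qed.

(** Elements outside [<[x]>] square to 1, while [x] squares to z = x^2. The three patterns of
    squares are those needed to match factorizations in ['Q_8]. *)
Lemma D8_factor :
  exists z, [/\ z \in 'Z('D_8), z != 1,
    forall d : 'D_8, exists a b, [/\ d = a * b, a * a = 1 & b * b = 1],
    forall d, d \notin 'Z('D_8) -> exists a b, [/\ d = a * b, a * a = z & b * b = 1]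
    & forall d, d \in 'Z('D_8) -> exists a b, [/\ d = a * b, a * a = z & b * b = z]].
Proof.
have [x [y [[Gx Gy X'y] sqX' ox [Zxx _]]]] := D8_generators.
have {}sqX' t : t \notin <[x]> -> t * t = 1.
  by move=> X't; apply: sqX'; rewrite !inE X't.
have x'x' : x^-1 * x^-1 = x * x.
  apply/eqP; rewrite -invMg eq_invg_mul -!expg2 -expgM.
  by rewrite -order_dvdn ox.
exists (x * x); split=> //; first exact: sqr_neq1_order4.
- move=> d; case: (boolP (d \in <[x]>)) => Xd.
    exists (d * y^-1), y; rewrite mulgKV (sqX' y) // (sqX' (_ * _)) //.
    by rewrite groupMl // groupV.
  by exists d, 1; rewrite !mulg1 sqX'.
- move=> d Z'd; case: (boolP (d \in <[x]>)) => Xd.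
    by exists d, 1; rewrite !mulg1 (sqr_cycle4 ox Zxx Xd Z'd).
  exists x, (x^-1 * d); rewrite mulKVg (sqX' (_ * _)) //.
  by rewrite groupMl // groupV cycle_id.
(* Since [d] commutes with [x] and squares to 1, [x^-1 * d] squares to x^-2 = z. *)
move=> d Zd; exists x, (x^-1 * d); rewrite mulKVg; split=> //.
have cdx : commute d x^-1 by case/centerP: Zd => _; apply; rewrite inE.
have dd : d * d = 1.
  apply/eqP; rewrite -expg2 -order_dvdn.
  by have:= order_dvdG Zd; rewrite card_center_D8.
by rewrite mulgA -(mulgA x^-1 d) cdx mulgA x'x' -mulgA dd mulg1.
Qed.

(** * Adjoining one central factor ['D_8] *)

Lemma Q2D4S_cprod k :
  exists (f : {morphism [set: Q2D4 k] >-> Q2D4 k.+1})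
         (g : {morphism 'D_8 >-> Q2D4 k.+1}),
    [/\ 'injm f /\ 'injm g, f @* [set: Q2D4 k] \* g @* 'D_8 = [set: Q2D4 k.+1],
        f @* [set: Q2D4 k] :&: g @* 'D_8 = 'Z([set: Q2D4 k.+1]),
        f @* 'Z([set: Q2D4 k]) = 'Z([set: Q2D4 k.+1])
      & g @* 'Z('D_8) = 'Z([set: Q2D4 k.+1])].
Proof.
have [gz isoZ] := Q2D4P k.
exists (cpairg1 isoZ), (cpair1g isoZ); split.
- by rewrite injm_cpairg1 injm_cpair1g.
- exact: im_cpair_cprod.
- rewrite setI_im_cpair -(cpairg1_center isoZ) injm_center // injm_cpairg1 //.
- exact: cpairg1_center.
exact: cpair1g_center.
Qed.

Lemma center_Q2D4_neq1_inj k u v :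
  u \in 'Z([set: Q2D4 k]) -> v \in 'Z([set: Q2D4 k]) ->
  u != 1 -> v != 1 -> u = v.
Proof.
have /cyclicP[w defZ] : cyclic 'Z([set: Q2D4 k]).
  by rewrite prime_cyclic ?card_center_Q2D4.
have ow : #[w] = 2 by rewrite orderE -defZ card_center_Q2D4.
rewrite defZ cycle2g // !in_set2.
by move=> /orP[/eqP->|/eqP->] /orP[/eqP->|/eqP->]; rewrite ?eqxx.
Qed.

(** * Strong reality *)

Lemma strongly_real_of_sq (gT : finGroupType) (G : {group gT}) :
  (forall g, g \in G ->
     exists x y, [/\ x \in G, y \in G, x * x = 1, y * y = 1 & g = x * y]) ->
  strongly_real G.
Proof.
move=> srG g /srG[x [y [Gx Gy x2 y2 ->]]].
by exists x, y; rewrite !invg_id_of_sq.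
Qed.

Lemma mul_commute_sq (gT : finGroupType) (a b : gT) :
  commute a b -> (a * b) * (a * b) = a * a * (b * b).
Proof. by move=> cab; rewrite !mulgA -(mulgA a b a) -cab !mulgA. Qed.

(** With u = a b and d = s t, f u g d = (f a g s)(f b g t); both factors square to 1 because the
    images of [f] and [g] commute. *)
Lemma strongly_real_Q2D4S k :
  strongly_real [set: Q2D4 k]%G -> strongly_real [set: Q2D4 k.+1]%G.
Proof.
move=> srk; have [f [g [_ defC _ _ _]]] := Q2D4S_cprod k.
apply: strongly_real_of_sq => c _.
have [_ eqC cfg] := cprodP defC.
have : c \in f @* [set: Q2D4 k] * g @* 'D_8 by rewrite eqC in_setT.
have comfg u d : commute (f u) (g d).
  by apply/commute_sym/(centsP cfg); rewrite mem_morphim ?in_setT.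
case/mulsgP=> _ _ /morphimP[u _ _ ->] /morphimP[d _ _ ->] -> {c}.
have [a [b [_ _ a1 b1 ->]]] := srk u (in_setT u).
have a2 : a * a = 1 by rewrite -{1}a1 mulVg.
have b2 : b * b = 1 by rewrite -{1}b1 mulVg.
have [z [_ _ /(_ d)[s [t [-> s2 t2]]] _ _]] := D8_factor.
exists (f a * g s), (f b * g t); rewrite !in_setT; split=> //.
- by rewrite mul_commute_sq // -!morphM ?in_setT // s2 a2 !morph1 mulg1.
- by rewrite mul_commute_sq // -!morphM ?in_setT // t2 b2 !morph1 mulg1.
by rewrite !morphM ?in_setT // !mulgA -(mulgA (f a) (f b)) (comfg b s) !mulgA.
Qed.

Lemma strongly_real_Q8D8 : strongly_real [set: Q2D4 1]%G.
Proof.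
have [f [g [[injf injg] defC _ fZ gZ]]] := Q2D4S_cprod 0.
apply: strongly_real_of_sq => c _.
have [_ eqC cfg] := cprodP defC.
have : c \in f @* [set: Q2D4 0] * g @* 'D_8 by rewrite eqC in_setT.
have comfg u d : commute (f u) (g d).
  by apply/commute_sym/(centsP cfg); rewrite mem_morphim ?in_setT.
have fM : {morph f : u v / u * v} by move=> u v; rewrite morphM ?in_setT.
have gM : {morph g : u v / u * v} by move=> u v; rewrite morphM ?in_setT.
case/mulsgP=> _ _ /morphimP[u _ _ ->] /morphimP[d _ _ ->] -> {c}.
have [zQ [ZzQ nzQ sqQ facQ]] := Q8_factor.
have [zD [ZzD nzD facD facD' facZD]] := D8_factor.
have eqz : f zQ = g zD.
  apply: center_Q2D4_neq1_inj; rewrite ?morph_injm_eq1 ?in_setT //.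
  - by rewrite -fZ; apply: mem_morphim; rewrite ?in_setT.
  by rewrite -gZ; apply: mem_morphim; rewrite ?in_setT.
have sqz : f zQ * g zD = 1.
  rewrite eqz -gM.
  have : #[zD] %| 2 by have:= order_dvdG ZzD; rewrite card_center_D8.
  by rewrite order_dvdn expg2 => /eqP->; rewrite morph1.
have sq a b : a * a = zQ -> b * b = zD -> (f a * g b) * (f a * g b) = 1.
  by move=> a2 b2; rewrite mul_commute_sq // -fM -gM a2 b2.
have sq1 a b : a * a = 1 -> b * b = 1 -> (f a * g b) * (f a * g b) = 1.
  by move=> a2 b2; rewrite mul_commute_sq // -fM -gM a2 b2 !morph1 mulg1.
have split4 a b s t : f (a * b) * g (s * t) = (f a * g s) * (f b * g t).
  by rewrite fM gM !mulgA -(mulgA (f a) (f b)) (comfg b s) !mulgA.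
(* A central [u] squares to 1, so it can join one of the two factors of square 1 of [d]. *)
have [Zu | Z'u] := boolP (u \in 'Z('Q_8)).
  have u2 : u * u = 1.
    apply/eqP; rewrite -expg2 -order_dvdn.
    by have:= order_dvdG Zu; have /= := card_center_Q2D4 0 => ->.
  have [a [b [-> a2 b2]]] := facD d.
  exists (f u * g a), (f 1 * g b); rewrite !in_setT !sq1 ?mulg1 //.
  by rewrite -split4 mulg1.
(* Now [u] squares to z. If [d] is central, all four factors are chosen of square z; otherwise
   [d = a * b] with [a] of square z, which is paired with [u]. *)
have [Zd | /facD'[a [b [-> a2 b2]]]] := boolP (d \in 'Z('D_8)).
  have [[a [b [-> a2 b2]]] [s [t [-> s2 t2]]]] := (facQ u, facZD d Zd).
  exists (f a * g s), (f b * g t); rewrite !in_setT split4.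
  by split=> //; apply: sq.
exists (f u * g a), (f 1 * g b); rewrite !in_setT -{3}[u]mulg1 split4.
by split=> //; [apply: sq; rewrite ?sqQ | apply: sq1; rewrite ?mulg1].
Qed.

(** The induction starts with one factor ['D_8]: ['Q_8] alone is not strongly real, its square roots
    of 1 being central. *)
Lemma strongly_real_Q2D4 k : strongly_real [set: Q2D4 k.+1]%G.
Proof.
elim: k => [|k IHk]; [exact: strongly_real_Q8D8 | exact: strongly_real_Q2D4S].
Qed.

Import Order.TTheory GRing.Theory Num.Theory.
Local Open Scope ring_scope.

(** * Group order and irreducible representations with z = -1 *)

(** The two factors meet in the center, of order 2, so each ['D_8] multiplies the order by 8 / 2. *)
Lemma card_Q2D4 k : #|[set: Q2D4 k]| = (8 * 4 ^ k)%N.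
Proof.
elim: k => [|k IHk]; first by rewrite (@card_quaternion 3).
have [f [g [[injf injg] defC defI _ _]]] := Q2D4S_cprod k.
have [_ eqC cfg] := cprodP defC.
have := mul_cardG (f @* [set: Q2D4 k]) (g @* 'D_8).
rewrite eqC defI card_center_Q2D4 !card_injm // IHk (@card_2dihedral 3) //.
move=> oC2; apply/eqP; rewrite -(eqn_pmul2r (m := 2)) //; apply/eqP.
by rewrite -[LHS]oC2 (expnS 4); lia.
Qed.

(** The images of the elements of [G] span the full matrix algebra, of dimension n^2. *)
Lemma abs_irr_degree_sq (F : fieldType) (gT : finGroupType) (G : {group gT}) n
    (rG : mx_representation F G n) :
  mx_absolutely_irreducible rG -> (n ^ 2 <= #|G|)%N.
Proof. by rewrite -mulnn => /andP[_ /eqP <-]; apply: rank_leq_row. Qed.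

(** In the regular representation the kernel of z + 1 is a submodule, and nonzero by faithfulness,
    since (z - 1)(z + 1) = 0. A simple submodule of it is the required representation. *)
Lemma irr_center_neg_exists (F : fieldType) (gT : finGroupType)
    (G : {group gT}) z :
  (2%:R : F) != 0 -> z \in 'Z(G) -> z != 1%g -> (z * z)%g = 1%g ->
  ~ (forall n (rG : mx_representation F G n),
       mx_irreducible rG -> rG z <> - 1%:M).
Proof.
move=> nz2 Zz nz1 z2 no_irr.
have [Gz cz] := centerP _ _ Zz.
pose rG := regular_repr F G; pose f := rG z + 1%:M.
have cf : centgmx rG f.
  apply/centgmxP=> x Gx; rewrite mulmxDl mulmxDr mul1mx mulmx1.
  by rewrite -!repr_mxM // cz.
have modU := kermx_centg_module cf.
have nzU : kermx f != 0.
  apply: contra nz1 => /eqP U0.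
  have : (rG z - 1%:M <= kermx f)%MS.
    apply/sub_kermxP; rewrite mulmxDr mulmxBl mulmx1 mul1mx -repr_mxM // z2.
    by rewrite repr_mx1 addrA subrK subrr.
  rewrite U0 submx0 subr_eq0 => /eqP rz1.
  have /subsetP/(_ z) := regular_mx_faithful F G.
  by rewrite !inE Gz mul1mx rz1 eqxx => /(_ isT).
(* The existence of a simple submodule is a [classically] statement, usable for a boolean goal;
   hence the doubly negated form of the lemma. *)
suff: false by [].
apply: (mxsimple_exists modU nzU) => -[V simV sVU].
have modV := mxsimple_module simV.
case: (no_irr _ (submod_repr modV)); first exact/submod_mx_irr.
apply: (@val_submod_inj _ _ V).
rewrite -[submod_repr _ z]mul1mx val_submodJ // linearN /=.
apply/eqP; rewrite -subr_eq0 opprK -{2}[val_submod _]mulmx1 -mulmxDr.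
by apply/eqP/sub_kermxP/(submx_trans _ sVU)/val_submodP.
Qed.

(** * Lower bound for the degrees of real representations *)

(* B exchanges the eigenspaces of A for 1 and -1. *)
Lemma anticommuting_involution_half (F : fieldType) (gT : finGroupType)
    (H : {group gT}) n (rH : mx_representation F H n) (A B : 'M[F]_n) :
  (2%:R : F) != 0 -> centgmx rH A -> A *m A = 1%:M -> B \in unitmx ->
  A *m B = - (B *m A) ->
  exists m (rU : mx_representation F H m), n = (m + m)%N /\
    forall x c, x \in H -> rH x = c%:M -> rU x = c%:M.
Proof.
move=> nz2 cA A2 uB AB.
have cA1 : centgmx rH (A - 1%:M).
  apply/centgmxP=> x Hx; rewrite mulmxBl mulmxBr mul1mx mulmx1.
  by rewrite (centgmxP cA).
have modU := kermx_centg_module cA1.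
(* Anticommutation gives (A - 1) B = - B (A + 1), with [B] invertible. *)
have eq_rank : \rank (A + 1%:M)%R = \rank (A - 1%:M)%R.
  have freeB : row_free B by rewrite row_free_unit.
  have fullB : row_full B by rewrite row_full_unit.
  rewrite -(mxrankMfree (A - _) freeB) mulmxBl AB mul1mx -{2}[B]mulmx1 -opprD.
  by rewrite -mulmxDr mxrank_opp (eqmxMfull _ fullB).
(* At most n because the product of the two matrices is 0, at least n because their difference is
   the invertible scalar 2. *)
have rankD : (\rank (A - 1%:M)%R + \rank (A + 1%:M)%R)%N = n.
  apply/eqP; rewrite eqn_leq mulmx0_rank_max /=; last first.
    by rewrite mulmxBl mulmxDr A2 mulmx1 mul1mx [1%:M + A]addrC subrr.
  have rank2 : \rank ((1 + 1)%:M : 'M[F]_n) = n.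
    by apply/eqP; rewrite [_ == _]row_free_unit unitmxE det_scalar unitrX // unitfE.
  apply: leq_trans (eq_leq (esym rank2)) _.
  have -> : (1 + 1)%:M = (A + 1%:M) - (A - 1%:M) :> 'M[F]_n.
    by rewrite raddfD opprB [RHS]addrC addrA subrK.
  by rewrite addnC -(mxrank_opp (A - _)); apply: mxrank_add.
exists (\rank (kermx (A - 1%:M))), (submod_repr modU); split.
  rewrite mxrank_ker; move: rankD; rewrite eq_rank; lia.
move=> x c Hx rx; apply: (@val_submod_inj _ _ (kermx (A - 1%:M))).
rewrite -[submod_repr _ x]mul1mx val_submodJ // rx.
by rewrite mul_mx_scalar -[c%:M]scalemx1 linearZ.
Qed.

(** For v nonzero, the rows v, v I, v J, v I J are independent: a relation reads v q = 0 with q a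
    quaternion, and multiplying by the conjugate q' makes a sum of four squares vanish. *)
Lemma quaternionic_degree_ge4 (R : realFieldType) n (I J : 'M[R]_n) :
  (0 < n)%N -> I *m I = - 1%:M -> J *m J = - 1%:M ->
  I *m J = - (J *m I) -> (4 <= n)%N.
Proof.
move=> n0 I2 J2 IJ.
pose v : 'rV[R]_n := delta_mx 0 (Ordinal n0).
have v0 : v != 0.
  by apply/eqP=> /matrixP/(_ 0 (Ordinal n0))/eqP; rewrite !mxE !eqxx oner_eq0.
pose M := col_mx (col_mx v (v *m I)) (col_mx (v *m J) (v *m I *m J)).
suffices /eqP rankM : row_free M
  by apply: leq_trans (rank_leq_col M); rewrite rankM.
rewrite -kermx_eq0; apply/rowV0P=> u /sub_kermxP.
pose a := lsubmx (lsubmx u) 0 0; pose b := rsubmx (lsubmx u) 0 0.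
pose c := lsubmx (rsubmx u) 0 0; pose d := rsubmx (rsubmx u) 0 0.
have -> : u = row_mx (row_mx a%:M b%:M) (row_mx c%:M d%:M).
  by rewrite -!mx11_scalar !hsubmxK.
rewrite !mul_row_col !mul_scalar_mx => uM.
pose q := a%:M + b *: I + (c *: J + d *: (I *m J)).
have vq : v *m q = 0.
  by rewrite -[RHS]uM !mulmxDr mul_mx_scalar -!scalemxAr mulmxA.
pose q' := a%:M - b *: I - (c *: J + d *: (I *m J)).
have JI : J *m I = - (I *m J) by rewrite IJ opprK.
have qq' : q *m q' = (a ^+ 2 + b ^+ 2 + c ^+ 2 + d ^+ 2)%:M.
  (* With X the pure part of q, q q' = (a + X)(a - X) = a^2 - X^2. *)
  pose K := I *m J; pose X := b *: I + (c *: J + d *: K).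
  have KI : K *m I = J by rewrite -mulmxA JI mulmxN mulmxA I2 mulNmx mul1mx opprK.
  have IK : I *m K = - J by rewrite mulmxA I2 mulNmx mul1mx.
  have KJ : K *m J = - I by rewrite -mulmxA J2 mulmxN mulmx1.
  have JK : J *m K = I by rewrite mulmxA JI mulNmx -mulmxA J2 mulmxN mulmx1 opprK.
  have KK : K *m K = - 1%:M by rewrite -{2}/K mulmxA KI J2.
  have XX : X *m X = (- (b ^+ 2 + c ^+ 2 + d ^+ 2))%:M.
    rewrite /X !(mulmxDl, mulmxDr) -!(scalemxAl, scalemxAr).
    rewrite I2 J2 KK IK KI JK KJ JI -/K.
    by apply/matrixP=> s t; rewrite !mxE; ring.
  have -> : q *m q' = (a%:M + X) *m (a%:M - X) by rewrite /q /q' /X !opprD !addrA.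
  clearbody X; rewrite mulmxBr !mulmxDl XX !(mul_mx_scalar, mul_scalar_mx).
  by apply/matrixP=> s t; rewrite !mxE; ring.
have /eqP := congr1 (mulmx^~ q') vq.
rewrite mul0mx -mulmxA qq' mul_mx_scalar scaler_eq0 (negPf v0) orbF => /eqP abcd.
have [a0 b0 c0 d0] : [/\ a = 0, b = 0, c = 0 & d = 0] by split; nra.
by rewrite a0 b0 c0 d0 !raddf0 !row_mx0.
Qed.

Lemma repr_center_neg_neq1 (F : fieldType) (gT : finGroupType)
    (G : {group gT}) n (rG : mx_representation F G n) z :
  (2%:R : F) != 0 -> (0 < n)%N -> rG z = - 1%:M -> z != 1%g.
Proof.
move=> nz2 n0 rz; apply: contra_neq nz2 => z1.
move: rz; rewrite z1 repr_mx1 => /matrixP/(_ (Ordinal n0) (Ordinal n0)).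
by rewrite !mxE eqxx => /eqP; rewrite -subr_eq0 opprK => /eqP.
Qed.

(** The commutator of [x] and [y] is x^-2 = x^2. Where [x * x] acts as -1, the images of [x] and [y]
    therefore anticommute. *)
Lemma order4_swap (gT : finGroupType) (x y : gT) :
  #[x]%g = 4 -> (x ^ y = x^-1)%g -> commute (x * x)%g y ->
  (x * y = x * x * (y * x) /\ y * x = x * x * (x * y))%g.
Proof.
move=> ox xy cxx.
have x4 : (x * x * (x * x) = 1)%g.
  by apply/eqP; rewrite -!expg2 -expgM -order_dvdn ox.
have swap : (x * y = x * x * (y * x))%g.
  rewrite conjgC xy mulgA cxx -mulgA; congr (_ * _)%g.
  by apply/eqP; rewrite eq_invg_mul -x4 !mulgA.
by split=> //; rewrite swap mulgA x4 mul1g.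
Qed.

Lemma real_degree_Q2D4 (R : realFieldType) k n
    (rG : mx_representation R [set: Q2D4 k] n) z :
  (0 < n)%N -> z \in 'Z([set: Q2D4 k]) -> rG z = - 1%:M -> (4 * 2 ^ k <= n)%N.
Proof.
have nz2 : (2%:R : R) != 0 by rewrite pnatr_eq0.
(* The induction passes to a representation of half the degree and to a preimage of [z]. *)
elim: k => [|k IHk] in n rG z * => n0 Zz rz;
  have nz1 := repr_center_neg_neq1 nz2 n0 rz.
  have [x [y [[Gx Gy X'y] sqX' ox [Zxx xy]]]] := Q8_generators.
  have xx : (x * x)%g = z.
    by apply: (@center_Q2D4_neq1_inj 0) => //; apply: sqr_neq1_order4.
  have yy : (y * y)%g = z by rewrite -xx; apply: sqX'; rewrite inE X'y in_setT.
  have yx : (x * y)%g = (z * (y * x))%g.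
    have [|-> _] := order4_swap ox xy; last by rewrite xx.
    by case/centerP: Zxx => _; apply; rewrite in_setT.
  have rM u v : rG (u * v)%g = rG u *m rG v by rewrite repr_mxM ?in_setT.
  rewrite muln1; apply: (quaternionic_degree_ge4 (I := rG x) (J := rG y)) => //.
  - by rewrite -rM xx.
  - by rewrite -rM yy.
  by rewrite -rM yx !rM rz mulNmx mul1mx.
have [f [g [[injf injg] defC _ fZ gZ]]] := Q2D4S_cprod k.
have [_ eqC cfg] := cprodP defC.
have [x [y [[Gx Gy X'y] sqX' ox [Zxx xy]]]] := D8_generators.
have rM u v : rG (u * v)%g = rG u *m rG v by rewrite repr_mxM ?in_setT.
have rH_repr : mx_repr [set: Q2D4 k] (rG \o f).
  split=> [|u v _ _] /=; first by rewrite morph1 repr_mx1.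
  by rewrite morphM ?rM ?in_setT.
pose rH := MxRepresentation rH_repr.
have yy : (y * y)%g = 1%g by apply: sqX'; rewrite inE X'y in_setT.
have gxx : g (x * x)%g = z.
  apply: center_Q2D4_neq1_inj => //; last first.
    by rewrite morph_injm_eq1 ?in_setT ?sqr_neq1_order4.
  by rewrite -gZ; apply: mem_morphim; rewrite ?in_setT.
have [z' Zz' fz'] : exists2 z', z' \in 'Z([set: Q2D4 k]) & f z' = z.
  by move: Zz; rewrite -fZ => /morphimP[z' _ Zz' ->]; exists z'.
(* The involution [y] gives A, which commutes with the image of [f]; [x] gives B, which anticommutes
   with A because [g (x * x)] is [z]. *)
have [||||m [rU [def_n rUE]]] :=
    @anticommuting_involution_half R _ _ _ rH (rG (g y)) (rG (g x)) nz2.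
- apply/centgmxP=> u _ /=; rewrite -!rM; congr (rG _).
  by apply/(centsP cfg); rewrite mem_morphim ?in_setT.
- by rewrite -rM -morphM ?in_setT // yy morph1 repr_mx1.
- by rewrite repr_mx_unit ?in_setT.
- have -> : rG (g y) *m rG (g x) = rG z *m (rG (g x) *m rG (g y)).
    rewrite -gxx -!rM -!morphM ?in_setT //; congr (rG (g _)).
    have [|//] := order4_swap ox xy.
    by case/centerP: Zxx => _; apply; rewrite in_setT.
  by rewrite rz mulNmx mul1mx.
have m0 : (0 < m)%N by move: n0; rewrite def_n; case: (m).
have le_m : (4 * 2 ^ k <= m)%N.
  by apply: (IHk _ rU z'); rewrite // (rUE _ (- 1)) ?in_setT ?raddfN //= fz' rz.
by rewrite def_n expnS mulnCA mul2n -addnn leq_add.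
Qed.

(** * Comparison of the real and complex degree bounds *)

Theorem mainTheorem3 (R : realType) (n : nat) (hn : (2 <= n)%N) :
  strongly_real [set: Q2D4 n.-1]%G /\
  ~ totally_orthogonal [set: Q2D4 n.-1]%G R.
Proof.
case: n hn => [|[|k]] // _; rewrite [_.-1]/=.
split; first exact: strongly_real_Q2D4.
case=> _ real_irr.
have [z Zz nz1] : exists2 z, z \in 'Z([set: Q2D4 k.+1]) & z != 1%g.
  by apply/trivgPn; rewrite -cardG_gt1 card_center_Q2D4.
have z2 : (z * z)%g = 1%g.
  apply/eqP; rewrite -expg2 -order_dvdn.
  by have := order_dvdG Zz; rewrite card_center_Q2D4.
have nz2 : (2%:R : R[i]) != 0 by rewrite pnatr_eq0.
apply: (irr_center_neg_exists nz2 Zz nz1 z2) => m rG irrG rz.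
have [rG0 sim0] := real_irr _ _ irrG.
(* [R[i]] is algebraically closed, so irreducibility is absolute. *)
have absG := group_closure_closed_field irrG.
have leG := abs_irr_degree_sq absG.
have m0 : (0 < m)%N by case/mx_irrP: irrG.
have [B [B' BB' simB]] := mx_rsim_def (mx_rsim_sym sim0).
have rz0 : rG0 z = - 1%:M.
  apply/(map_mx_inj (f := real_complex R)); rewrite -map_reprE simB ?in_setT //.
  by rewrite rz mulmxN mulmx1 mulNmx (mulmx1C BB') map_mxN map_mx1.
have := real_degree_Q2D4 m0 Zz rz0.
have four_pow : (4 ^ k.+1 = (2 ^ k.+1) ^ 2)%N by rewrite -expnM mulnC expnM.
(* Squaring gives 16 * 4^(k+1) <= m^2 <= 8 * 4^(k+1), which is absurd. *)
rewrite -leq_sqr => /leq_trans/(_ leG).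
by rewrite card_Q2D4 four_pow expnMn leq_pmul2r ?expn_gt0.
Qed.
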